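(* There is an arithmetic term $T_3$ in one variable such that for every natural number $n \geq 2$, the value $T_3(n)$ is equal to the greatest prime dividing $n$.
   Context: $\mathbb{N}$ includes $0$. Arithmetic terms are the expressions, interpreted as functions on $\mathbb{N}$, defined inductively: the constants $0$, $1$ and the variables are arithmetic terms; if $t_1, t_2$ are arithmetic terms, then so are $(t_1 + t_2)$, $(t_1 \mathbin{\dot{-}} t_2)$, $(t_1 * t_2)$, $(t_1 / t_2)$ and $2^{t_1}$. Here $a \mathbin{\dot{-}} b = \max(a-b, 0)$ and $a/b = \lfloor a/b \rfloor$ is the quotient of integer division, with $a/0 := 0$. *)

(* Defs.v *)
From mathcomp Require Import all_boot.

Set Implicit Arguments.
Unset Strict Implicit.
Unset Printing Implicit Defensive.

(** Arithmetic terms in the [k] variables [x_0, ..., x_(k-1)]. *)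
Inductive aterm (k : nat) : Type :=
| AZero : aterm k
| AOne : aterm k
| AVar : 'I_k -> aterm k
| AAdd : aterm k -> aterm k -> aterm k
| AMonus : aterm k -> aterm k -> aterm k
| AMul : aterm k -> aterm k -> aterm k
| ADiv : aterm k -> aterm k -> aterm k
| AExp2 : aterm k -> aterm k.

(** On [nat], [a - b] is truncated at 0 and [a %/ 0 = 0] ([divn0]). *)
Fixpoint aeval (k : nat) (v : 'I_k -> nat) (t : aterm k) : nat :=
  match t with
  | AZero => 0
  | AOne => 1
  | AVar i => v i
  | AAdd t1 t2 => aeval v t1 + aeval v t2
  | AMonus t1 t2 => aeval v t1 - aeval v t2
  | AMul t1 t2 => aeval v t1 * aeval v t2
  | ADiv t1 t2 => aeval v t1 %/ aeval v t2
  | AExp2 t1 => 2 ^ aeval v t1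
  end.

(* Main.v *)
Require Import Defs.
From mathcomp Require Import all_boot.
From mathcomp Require Import zify.

Set Implicit Arguments.
Unset Strict Implicit.
Unset Printing Implicit Defensive.

(** The greatest prime factor of [n] is [n] minus the number of [i < n] with
    [n %| i`! ^ n]. These [i] are counted as the solutions in a box of a system
    of exponential equations in [i] and eight auxiliary unknowns, each such [i]
    extending to exactly one solution. The number of zeros of an exponential
    polynomial [E >= 0] over a box is an arithmetic term: the sum of
    [(2 ^ w - 1) * E s * B ^ (index of s)] has a closed form because [E] is a
    sum of products of one-variable terms [x ^ a * g ^ x], and its digits in
    base [B = 2 ^ (2 * w)] have Hamming weight [w] or [0] according to whether
    [E s] is nonzero. The Hamming weight of [x] is the 2-adic valuation of
    ['C(2 * x, x)], which is obtained from a binomial coefficient (a digit of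
    [(1 + T) ^ m]), a gcd (the number of solutions of [i * a = j * b], again
    read off as a digit) and a base-2 logarithm. *)

(** * Closure properties of functions given by arithmetic terms *)

Definition definable (f : nat -> nat) :=
  exists t : aterm 1, forall n, 2 <= n -> aeval (fun _ : 'I_1 => n) t = f n.

Lemma definable_ext f g :
  (forall n, 2 <= n -> f n = g n) -> definable f -> definable g.
Proof. by move=> fg [t tf]; exists t => n n2; rewrite tf ?fg. Qed.

Lemma definable_id : definable id.
Proof. by exists (AVar ord0). Qed.

Lemma definableD f g :
  definable f -> definable g -> definable (fun n => f n + g n).
Proof. by move=> [t tf] [u ug]; exists (AAdd t u) => n n2 /=; rewrite tf ?ug. Qed.

Lemma definableB f g :
  definable f -> definable g -> definable (fun n => f n - g n).
Proof. by move=> [t tf] [u ug]; exists (AMonus t u) => n n2 /=; rewrite tf ?ug. Qed.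

Lemma definableM f g :
  definable f -> definable g -> definable (fun n => f n * g n).
Proof. by move=> [t tf] [u ug]; exists (AMul t u) => n n2 /=; rewrite tf ?ug. Qed.

Lemma definable_div f g :
  definable f -> definable g -> definable (fun n => f n %/ g n).
Proof. by move=> [t tf] [u ug]; exists (ADiv t u) => n n2 /=; rewrite tf ?ug. Qed.

Lemma definable_exp2 f : definable f -> definable (fun n => 2 ^ f n).
Proof. by move=> [t tf]; exists (AExp2 t) => n n2 /=; rewrite tf. Qed.

Lemma definable_cst c : definable (fun=> c).
Proof.
elim: c => [|c [t tf]]; first by exists (AZero 1).
by exists (AAdd (AOne 1) t) => n n2 /=; rewrite tf.
Qed.

Lemma definable_mod f g :
  definable f -> definable g -> definable (fun n => f n %% g n).
Proof.
move=> df dg.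
apply: (@definable_ext (fun n => f n - f n %/ g n * g n)) => [n _|].
  by rewrite {1}(divn_eq (f n) (g n)) addKn.
by apply/definableB/definableM => //; apply: definable_div.
Qed.

Lemma definable_prod (I : Type) (r : seq I) (F : I -> nat -> nat) :
  (forall i, definable (F i)) -> definable (fun n => \prod_(i <- r) F i n).
Proof.
move=> dF; elim: r => [|i r IH].
  by apply: definable_ext (definable_cst 1) => n _; rewrite big_nil.
apply: definable_ext (definableM (dF i) IH) => n _; by rewrite big_cons.
Qed.

Lemma definable_sum (I : Type) (r : seq I) (F : I -> nat -> nat) :
  (forall i, definable (F i)) -> definable (fun n => \sum_(i <- r) F i n).
Proof.
move=> dF; elim: r => [|i r IH].
  by apply: definable_ext (definable_cst 0) => n _; rewrite big_nil.
apply: definable_ext (definableD (dF i) IH) => n _; by rewrite big_cons.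
Qed.

(** * Powers, digit extraction and binomial coefficients *)

Lemma exp2_mod_expn W x y :
  x ^ y + x < 2 ^ W -> 2 ^ (W * y) %% (2 ^ W - x) = x ^ y.
Proof.
move=> lt_xW; have lexW : x <= 2 ^ W by lia.
(* Modulo [2 ^ W - x], the number [2 ^ W] is congruent to [x], hence its [y]-th power to [x ^ y],
   which is below the modulus. *)
rewrite expnM -{1}(subnK lexW) -modnXm modnDl modnXm modn_small //; lia.
Qed.

Lemma expn_lt_exp2 x y : x ^ y + x < 2 ^ (x * y + x + 1).
Proof.
have lt_x := ltn_expl x (ltnSn 1).
have le_xy : x ^ y <= 2 ^ (x * y).
  by rewrite expnM; case: y => // y; rewrite leq_exp2r // ltnW.
have [h1 h2] : 0 < 2 ^ x /\ 0 < 2 ^ (x * y) by rewrite !expn_gt0.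
rewrite !expnD expn1; nia.
Qed.

Lemma definableX f g :
  definable f -> definable g -> definable (fun n => f n ^ g n).
Proof.
move=> df dg; pose W n := f n * g n + f n + 1.
have dW : definable W.
  by apply/definableD/definable_cst/definableD => //; apply: definableM.
apply: (@definable_ext (fun n => 2 ^ (W n * g n) %% (2 ^ W n - f n))) => [n _|].
  by rewrite exp2_mod_expn // expn_lt_exp2.
apply: definable_mod; first by apply/definable_exp2/definableM.
by apply/definableB => //; apply/definable_exp2.
Qed.

Lemma sum_digits_lt T n (a : nat -> nat) :
  (forall i, a i < T) -> \sum_(i < n) a i * T ^ i < T ^ n.
Proof.
move=> aT; elim: n => [|n IH]; first by rewrite big_ord0.
rewrite big_ord_recr expnS /=; apply: (@leq_trans ((a n).+1 * T ^ n)).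
  by rewrite mulSn ltn_add2r.
by rewrite leq_mul2r aT orbT.
Qed.

Lemma digitP T u c v k : u < T ^ k -> c < T ->
  (u + c * T ^ k + v * T ^ k.+1) %/ T ^ k %% T = c.
Proof.
move=> uT cT; have Tk : 0 < T ^ k by rewrite (leq_ltn_trans _ uT).
rewrite expnS mulnA -addnA -mulnDl addnC divnMDl // divn_small // addn0.
by rewrite addnC modnMDl modn_small.
Qed.

Lemma sum_digit T n (a : nat -> nat) k : (forall i, a i < T) -> k < n ->
  (\sum_(i < n) a i * T ^ i) %/ T ^ k %% T = a k.
Proof.
move=> aT ltkn.
rewrite -(subnKC ltkn) big_split_ord big_ord_recr /=.
under [X in _ + X]eq_bigr => i _ do rewrite expnD mulnCA mulnC.
by rewrite -big_distrl digitP //; apply: sum_digits_lt.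
Qed.

Lemma bin_le_exp2 n k : 'C(n, k) <= 2 ^ n.
Proof.
elim: n k => [|n IH] [|k] //; rewrite ?bin0 ?expn_gt0 // binS expnS mul2n -addnn.
exact: leq_add.
Qed.

(** In base [T], the binomial expansion of [(T + 1) ^ n] has the coefficients as digits, without
    carries since each is at most [2 ^ n]. *)
Lemma bin_digit T n k : 2 ^ n < T -> (T.+1 ^ n) %/ T ^ k %% T = 'C(n, k).
Proof.
move=> nT; rewrite -addn1 addnC.
(* The expansion is padded with zero coefficients so that position [k] exists even when [k > n]. *)
have -> : (1 + T) ^ n = \sum_(i < (n + k).+1) 'C(n, i) * T ^ i.
  rewrite -addSn big_split_ord /= [X in _ = _ + X]big1 ?addn0 => [|i _].
    by rewrite expnDn; apply: eq_bigr => i _; rewrite exp1n mul1n.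
  by rewrite bin_small ?leq_addr.
rewrite (@sum_digit _ _ (fun i => 'C(n, i))) ?ltnS ?leq_addl // => i.
exact: leq_ltn_trans (bin_le_exp2 n i) nT.
Qed.

Lemma definable_bin f g :
  definable f -> definable g -> definable (fun n => 'C(f n, g n)).
Proof.
move=> df dg; pose T n := 2 ^ (f n + 1).
have dT : definable T by apply/definable_exp2/definableD/definable_cst.
apply: (@definable_ext (fun n => ((1 + T n) ^ f n) %/ T n ^ g n %% T n)).
  by move=> n _; rewrite bin_digit // ltn_exp2l ?addn1.
apply/definable_mod => //; apply/definable_div; apply/definableX => //.
exact/definableD/dT/definable_cst.
Qed.

(** * Geometric sums, gcd and 2-adic valuation *)

(* Obtained by telescoping [x ^ c * G ^ x]; [0 ^ c] accounts for [0 ^ 0 = 1]. *)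
Lemma powsum_rec c G M : 0 < G ->
  (G - 1) * \sum_(x < M) x ^ c * G ^ x
    + G * \sum_(j < c) 'C(c, j) * \sum_(x < M) x ^ j * G ^ x + 0 ^ c
  = M ^ c * G ^ M.
Proof.
case: G => [//|G] _; rewrite subn1 /=; elim: M => [|M IH].
  rewrite big_ord0 big1 => [|j _]; last by rewrite big_ord0 muln0.
  by rewrite !muln0 muln1.
under [X in _ + _ * X]eq_bigr => j _ do rewrite big_ord_recr mulnDr mulnA /=.
rewrite big_split -big_distrl big_ord_recr /=.
have -> : M.+1 ^ c = \sum_(j < c) 'C(c, j) * M ^ j + M ^ c.
  rewrite -addn1 addnC expnDn big_ord_recr /= binn mul1n subnn mul1n.
  by congr (_ + _); apply: eq_bigr => j _; rewrite exp1n mul1n.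
rewrite expnS; move: IH.
set S := \sum_(x < M) _; set S' := \sum_(j < c) _ * \sum_(x < M) _.
set U := \sum_(j < c) _; set V := M ^ c; set K := _ ^ M => IH.
by rewrite mulnDl mulnCA -IH; nia.
Qed.

Lemma definable_powsum c G M : (forall n, 2 <= n -> 1 < G n) ->
  definable G -> definable M ->
  definable (fun n => \sum_(x < M n) x ^ c * G n ^ x).
Proof.
move=> G1 dG dM; elim/ltn_ind: c => c IH.
apply: (@definable_ext (fun n => (M n ^ c * G n ^ M n - 0 ^ c
   - G n * \sum_(j < c) 'C(c, j) * \sum_(x < M n) x ^ j * G n ^ x) %/ (G n - 1))).
  move=> n n2; rewrite -powsum_rec ?addnK ?mulKn ?subn_gt0 ?G1 //.
  exact: ltnW (G1 n n2).
apply/definable_div; last exact/definableB/definable_cst.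
apply/definableB.
  apply/definableB/definable_cst/definableM; apply/definableX => //.
  exact/definable_cst.
apply/definableM => //; apply: definable_sum => j.
exact/definableM/IH/ltn_ord/definable_cst.
Qed.

(** Terms with equal exponents pile up in one digit, and [#|I| < T] prevents carries. *)
Lemma count_digit (I : finType) (e : I -> nat) T d : #|I| < T ->
  (\sum_x T ^ e x) %/ T ^ d %% T = #|[set x | e x == d]|.
Proof.
move=> IT; pose D := (\max_x e x + d).+1.
have eD x : e x < D by rewrite ltnS (leq_trans (leq_bigmax x)) ?leq_addr.
rewrite (partition_big (fun x => Ordinal (eD x)) predT) //=.
rewrite (eq_bigr (fun i : 'I_D => #|[set x | e x == i]| * T ^ i)) => [|i _].
  rewrite (@sum_digit _ _ (fun i => #|[set x | e x == i]|)) //.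
    by move=> i; apply: leq_ltn_trans IT; apply: max_card.
  by rewrite ltnS leq_addl.
rewrite -sum_nat_const; apply: eq_big => [x|x /eqP <- //].
by rewrite inE -val_eqE.
Qed.

(** With [g] the gcd, coprimality forces [b %/ g] to divide [i]; the solutions are
    [i = l * (b %/ g)], [j + 1 = (g - l) * (a %/ g)] for [l < g]. *)
Lemma card_gcd a b : 0 < a -> 0 < b ->
  #|[set p : 'I_b * 'I_a | p.1 * a + b * p.2.+1 == a * b]| = gcdn a b.
Proof.
move=> a0 b0; set g := gcdn a b; have g0 : 0 < g by rewrite gcdn_gt0 a0.
pose a' := a %/ g; pose b' := b %/ g.
have Ea : a = a' * g by rewrite divnK // dvdn_gcdl.
have Eb : b = b' * g by rewrite divnK // dvdn_gcdr.
have [a'0 b'0] : 0 < a' /\ 0 < b' by move: a0 b0; rewrite Ea Eb !muln_gt0; lia.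
have cop : coprime b' a'.
  rewrite coprime_sym /coprime -(eqn_pmul2r g0) mul1n muln_gcdl.
  by rewrite -Ea -Eb.
have hb (l : 'I_g) : l * b' < b by rewrite Eb mulnC ltn_pmul2l.
have ha (l : 'I_g) : ((g - l) * a').-1 < a.
  by rewrite [X in _ < X]Ea; have := ltn_ord l; nia.
pose h l := (Ordinal (hb l), Ordinal (ha l)).
rewrite -[RHS]card_ord -[RHS](card_imset _ (f := h)) => [|l1 l2 []].
  apply: eq_card => -[i j]; rewrite !inE /=; apply/eqP/imsetP => /=.
    move=> E; have {}E : i * a' + b' * j.+1 = a' * g * b'.
      by apply/eqP; rewrite -(eqn_pmul2r g0); apply/eqP; nia.
    have /dvdnP[l El] : b' %| i.
      rewrite -(Gauss_dvdl _ cop) -(dvdn_addl _ (dvdn_mulr j.+1 (dvdnn b'))).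
      by rewrite E dvdn_mull.
    have lg : l < g by have := ltn_ord i; rewrite El; nia.
    have Ej : j.+1 = (g - l) * a' by nia.
    exists (Ordinal lg) => //; rewrite /h; congr (_, _); apply/val_inj => //=.
    by rewrite -Ej.
  case=> l _ [-> ->] /=; rewrite prednK; last by rewrite muln_gt0 subn_gt0 ltn_ord.
  by have := ltn_ord l; rewrite [in LHS]Ea [in LHS]Eb [in RHS]Ea [in RHS]Eb; nia.
by move=> /eqP; rewrite eqn_pmul2r // => /eqP /val_inj.
Qed.

(** The product expands into the sum of all [T ^ (i * a + b * (j + 1))], so its digit at position
    [a * b] counts the pairs of [card_gcd]. *)
Lemma gcdn_digit a b T : 0 < a -> 0 < b -> a * b < T ->
  ((\sum_(i < b) (T ^ a) ^ i) * (T ^ b * \sum_(j < a) (T ^ b) ^ j))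
    %/ T ^ (a * b) %% T = gcdn a b.
Proof.
move=> a0 b0 abT; rewrite -card_gcd // -(@count_digit _ _ T); last first.
  by rewrite card_prod !card_ord mulnC.
congr (_ %/ _ %% _); rewrite big_distrr big_distrlr pair_big /=.
by apply: eq_bigr => -[i j] _ /=; rewrite -expnS -!expnM -expnD mulnC.
Qed.

Lemma definable_geometric G M : (forall n, 2 <= n -> 1 < G n) ->
  definable G -> definable M -> definable (fun n => \sum_(x < M n) G n ^ x).
Proof.
move=> G1 dG dM; apply: definable_ext (definable_powsum 0 G1 dG dM) => n n2.
by apply: eq_bigr => i _; rewrite mul1n.
Qed.

Lemma definable_gcd f g :
  (forall n, 2 <= n -> 0 < f n) -> (forall n, 2 <= n -> 0 < g n) ->
  definable f -> definable g -> definable (fun n => gcdn (f n) (g n)).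
Proof.
move=> f0 g0 df dg; pose T n := f n * g n + 2.
have dT : definable T by apply/definableD/definable_cst/definableM.
have T1 n : 1 < T n by rewrite /T; lia.
have TX1 h n : 0 < h n -> 1 < T n ^ h n.
  by move=> h0; apply: leq_trans (T1 n) _; rewrite -{1}[T n]expn1 leq_exp2l.
apply: (@definable_ext (fun n =>
  ((\sum_(i < g n) (T n ^ f n) ^ i)
    * (T n ^ g n * \sum_(j < f n) (T n ^ g n) ^ j))
    %/ T n ^ (f n * g n) %% T n)) => [n n2|].
  by rewrite gcdn_digit ?f0 ?g0 // /T; lia.
apply/definable_mod => //; apply/definable_div; last first.
  by apply/definableX => //; apply/definableM.
have dX h : definable h -> definable (fun n => T n ^ h n) by apply/definableX.
apply/definableM; last apply/definableM/definable_geometric; try exact: dX.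
- by apply/definable_geometric; [move=> n n2; apply/TX1/f0|apply: dX|].
- by move=> n n2; apply/TX1/g0.
- by [].
Qed.

Lemma gcdn_exp2 m : 0 < m -> gcdn m (2 ^ m) = 2 ^ logn 2 m.
Proof.
move=> m0; have [o odd_o Em] := pfactor_coprime (isT : prime 2) m0.
have /ltnW lem := ltn_logl 2 m0.
have -> : 2 ^ m = 2 ^ (m - logn 2 m) * 2 ^ logn 2 m by rewrite -expnD subnK.
by rewrite {1}Em -muln_gcdl (eqP (coprimeXr _ _)) ?mul1n // coprime_sym.
Qed.

Lemma expn_binomial_mod D v : exists k, (1 + D) ^ v = 1 + v * D + k * D ^ 2.
Proof.
elim: v => [|v [k IH]]; first by exists 0.
by exists (v + k + k * D); rewrite expnSr IH; lia.
Qed.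

(** A discrete logarithm: with [D = 2 ^ K - 1], the power is [(1 + D) ^ v], congruent to [1 + v * D]
    modulo [D ^ 2], and the bound on [v] makes this the remainder. *)
Lemma log2_formula K v : v.+2 < 2 ^ K ->
  (2 ^ v) ^ K %% (2 ^ K - 1) ^ 2 %/ (2 ^ K - 1) = v.
Proof.
move=> vK; set D := 2 ^ K - 1.
rewrite -expnM mulnC expnM.
have -> : 2 ^ K = 1 + D by rewrite /D; lia.
have [k ->] := expn_binomial_mod D v.
have hD : v.+1 < D by rewrite /D; lia.
rewrite addnC modnMDl modn_small; last by nia.
by rewrite addnC divnMDl ?divn_small ?addn0; lia.
Qed.

Lemma definable_logn2 f : (forall n, 2 <= n -> 0 < f n) ->
  definable f -> definable (fun n => logn 2 (f n)).
Proof.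
move=> f0 df; pose K n := f n + 2.
have dK : definable K by apply/definableD/definable_cst.
have dD : definable (fun n => 2 ^ K n - 1).
  exact/definableB/definable_cst/definable_exp2.
apply: (@definable_ext (fun n => gcdn (f n) (2 ^ f n) ^ K n
   %% (2 ^ K n - 1) ^ 2 %/ (2 ^ K n - 1))) => [n n2|].
  rewrite gcdn_exp2 ?f0 // log2_formula //.
  have := ltn_logl 2 (f0 n n2); have := ltn_expl (K n) (ltnSn 1); rewrite /K; lia.
apply/definable_div => //; apply/definable_mod/definableX/definable_cst => //.
apply/definableX => //; apply/definable_gcd => //.
  by move=> n _; rewrite expn_gt0.
exact/definable_exp2.
Qed.

(** * Hamming weight *)

(* Legendre: [x - v_2(x!)] is the number of ones in the binary expansion of
   [x]. *)
Definition hamming x := x - logn 2 x`!.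

(** Odd factors contribute nothing, and the even ones [2, 4, ..., 2 * x] have product
    [2 ^ x * x!]. *)
Lemma logn2_fact_double (b : bool) x :
  logn 2 (b + x.*2)`! = x + logn 2 x`!.
Proof.
have odd0 y : logn 2 (y.*2).+1 = 0.
  by rewrite logn_coprime // coprime_sym coprimen2 /= odd_double.
have -> : logn 2 (b + x.*2)`! = logn 2 (x.*2)`!.
  by case: b; rewrite // add1n factS lognM ?fact_gt0 ?odd0.
elim: x => [|x IH] //.
rewrite doubleS !factS !lognM ?muln_gt0 ?fact_gt0 // IH odd0.
by rewrite -doubleS -mul2n lognM // logn_prime //=; lia.
Qed.

Lemma logn2_fact_le x : logn 2 x`! <= x.
Proof.
elim/ltn_ind: x => x IH; rewrite -(odd_double_half x) logn2_fact_double.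
have [->//|x0] := posnP x.
have : logn 2 (x./2)`! <= x./2 by apply: IH; lia.
by lia.
Qed.

Lemma hamming_double (b : bool) x : hamming (b + x.*2) = b + hamming x.
Proof.
by rewrite /hamming logn2_fact_double; have := logn2_fact_le x; lia.
Qed.

Lemma hamming_cat k a b : a < 2 ^ k ->
  hamming (a + b * 2 ^ k) = hamming a + hamming b.
Proof.
elim: k a => [|k IH] a ak; first by case: a ak => // _; rewrite muln1.
have -> : a + b * 2 ^ k.+1 = odd a + (a./2 + b * 2 ^ k).*2.
  by rewrite -{1}(odd_double_half a) expnS; lia.
rewrite hamming_double IH; last by move: ak; rewrite expnS; lia.
by rewrite -[in RHS](odd_double_half a) hamming_double addnA.
Qed.

Lemma hamming_complement w y : y < 2 ^ w ->
  hamming (2 ^ w - 1 - y) + hamming y = w.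
Proof.
elim: w y => [|w IH] y yw; first by case: y yw.
have -> : 2 ^ w.+1 - 1 - y = ~~ odd y + (2 ^ w - 1 - y./2).*2.
  by rewrite -{1}(odd_double_half y); move: yw; rewrite expnS; lia.
rewrite -{3}(odd_double_half y) !hamming_double.
have : y./2 < 2 ^ w by move: yw; rewrite expnS; lia.
by move=> /IH; lia.
Qed.

(** For [e = e' + 1] the product is [e' * 2 ^ w + (2 ^ w - 1 - e')]: the bits of [e'] above their
    complement in [w] bits. *)
Lemma hamming_mul_pred w e : 0 < e <= 2 ^ w -> hamming ((2 ^ w - 1) * e) = w.
Proof.
case: e => // e /andP[_ ew]; rewrite -[RHS](hamming_complement ew).
by rewrite -(@hamming_cat w); [congr hamming; nia | lia].
Qed.

Lemma hamming_sum d M (a : nat -> nat) : (forall x, x < M -> a x < 2 ^ d) ->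
  hamming (\sum_(x < M) a x * (2 ^ d) ^ x) = \sum_(x < M) hamming (a x).
Proof.
elim: M => [|M IH] ad; first by rewrite !big_ord0.
rewrite !big_ord_recr /= -IH => [|x xM]; last by rewrite ad // ltnW.
rewrite -expnM hamming_cat // expnM.
(* [sum_digits_lt] needs a bound at every index, so the digits are set to 0 outside the range. *)
rewrite (eq_bigr (fun x : 'I_M => (if x < M then a x else 0) * (2 ^ d) ^ x)).
  apply: (@sum_digits_lt _ _ (fun x => if x < M then a x else 0)) => x.
  by case: ifP => xM; [rewrite ad // ltnW | rewrite expn_gt0].
by move=> x _; rewrite ltn_ord.
Qed.

(** The valuation of [(2 * x)!] is [x] plus that of [x!]; dividing by [x! * x!] leaves [x] minus the
    valuation of [x!]. *)
Lemma hammingE x : hamming x = logn 2 'C(x.*2, x).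
Proof.
have lex : x <= x.*2 by lia.
have := congr1 (logn 2) (bin_fact lex).
have -> : x.*2 - x = x by lia.
rewrite !lognM ?muln_gt0 ?fact_gt0 ?bin_gt0 //.
by have := logn2_fact_double false x; rewrite add0n /hamming => ->; lia.
Qed.

Lemma definable_hamming f : definable f -> definable (fun n => hamming (f n)).
Proof.
move=> df; apply: (@definable_ext (fun n => logn 2 'C(2 * f n, f n))).
  by move=> n _; rewrite hammingE mul2n.
apply/definable_logn2 => [n _|]; first by rewrite bin_gt0; lia.
exact/definable_bin/df/definableM/df/definable_cst.
Qed.

(** * Counting the zeros of exponential polynomials in a box *)

Fixpoint in_box m (b : nat -> nat) (s : seq nat) : bool :=
  match m, s with
  | 0, [::] => true
  | m'.+1, x :: s' => (x < b 0) && in_box m' (b \o succn) s'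
  | _, _ => false
  end.

Fixpoint box_sum m (b : nat -> nat) (F : seq nat -> nat) : nat :=
  if m is m'.+1 then
    \sum_(x < b 0) box_sum m' (b \o succn) (fun s => F (val x :: s))
  else F [::].

Lemma eq_box_sum m b F G : (forall s, in_box m b s -> F s = G s) ->
  box_sum m b F = box_sum m b G.
Proof.
elim: m b F G => [|m IH] b F G FG /=; first exact: FG.
by apply: eq_bigr => x _; apply: IH => s sb; apply: FG; rewrite /= ltn_ord.
Qed.

Lemma box_sumD m b F G :
  box_sum m b (fun s => F s + G s) = box_sum m b F + box_sum m b G.
Proof.
elim: m b F G => [|m IH] b F G //=.
by rewrite -big_split; apply: eq_bigr => x _; rewrite IH.
Qed.

Lemma box_sumMl m b c F : box_sum m b (fun s => c * F s) = c * box_sum m b F.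
Proof.
elim: m b F => [|m IH] b F //=.
by rewrite big_distrr; apply: eq_bigr => x _; rewrite IH.
Qed.

Lemma leq_box_sum m b F s : in_box m b s -> F s <= box_sum m b F.
Proof.
elim: m b F s => [|m IH] b F [|x s] //= /andP[xb sb].
rewrite (bigD1 (Ordinal xb)) //=; apply: leq_trans (leq_addr _ _).
exact: (IH _ (fun s => F (x :: s))).
Qed.

Lemma box_sum_eq0 m b F : (forall s, in_box m b s -> F s = 0) ->
  box_sum m b F = 0.
Proof.
by move=> /eq_box_sum ->; rewrite (box_sumMl m b 0 (fun=> 0)).
Qed.

Lemma box_sum_single m b F s0 : in_box m b s0 ->
  (forall s, in_box m b s -> s != s0 -> F s = 0) -> box_sum m b F = F s0.
Proof.
elim: m b F s0 => [|m IH] b F [|x0 s0] //= /andP[xb sb] F0.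
rewrite (bigD1 (Ordinal xb)) //= big1 ?addn0.
  apply: (IH _ (fun s => F (x0 :: s))) => // s sb' ne.
  by apply: F0; rewrite /= ?xb // eqseq_cons eqxx.
move=> x ne; apply: box_sum_eq0 => s sb'.
by apply: F0; rewrite /= ?ltn_ord // eqseq_cons -val_eqE /= in ne *; rewrite (negbTE ne).
Qed.

Definition monomial m (a g : nat -> nat) (s : seq nat) :=
  \prod_(i < m) (nth 0 s i ^ a i * g i ^ nth 0 s i).

(** By distributivity a box sum of products of one-variable factors splits into sums of the kind
    treated in [definable_powsum]. *)
Lemma box_sum_monomial m b a g :
  box_sum m b (monomial m a g)
  = \prod_(i < m) \sum_(x < b i) x ^ a i * g i ^ x.
Proof.
elim: m b a g => [|m IH] b a g; first by rewrite /= /monomial !big_ord0.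
rewrite big_ord_recl big_distrl /=; apply: eq_bigr => x _.
rewrite -(IH (b \o succn) (a \o succn) (g \o succn)) -box_sumMl.
by apply: eq_box_sum => s _; rewrite /monomial big_ord_recl.
Qed.

Lemma box_sum_cst m b c : box_sum m b (fun=> c) = c * \prod_(i < m) b i.
Proof.
elim: m b => [|m IH] b; first by rewrite big_ord0 muln1.
rewrite big_ord_recl /=; under eq_bigr do rewrite IH.
by rewrite big_const_ord iter_addn_0 mulnC mulnCA.
Qed.

(* In mixed radix: digit [s] has [d] bits, and the digits of the sum over the
   variables of index greater than [i] fill exactly one digit in base
   [digit_base m d b i]. *)
Definition digit_base m d (b : nat -> nat) i :=
  2 ^ (d * \prod_(i.+1 <= j < m) b j).

(** For [w := digit_base m d b] this is [2 ^ d] raised to the mixed-radix index of [s]. *)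
Definition weight m (w : nat -> nat) (s : seq nat) :=
  \prod_(i < m) w i ^ nth 0 s i.

(** Induction on [m]: for each value of the first variable the inner sum is one digit in base
    [2 ^ D]. The size bound is carried along because it keeps these digits from overlapping. *)
Lemma hamming_box_sum m d b F : (forall s, in_box m b s -> F s < 2 ^ d) ->
  let X := box_sum m b (fun s => F s * weight m (digit_base m d b) s) in
  X < 2 ^ (d * \prod_(i < m) b i) /\ hamming X = box_sum m b (hamming \o F).
Proof.
elim: m b F => [|m IH] b F Fd /=.
  by rewrite /weight !big_ord0 !muln1; split=> //; apply: Fd.
pose Y x := box_sum m (b \o succn)
  (fun s => F (x :: s) * weight m (digit_base m d (b \o succn)) s).
pose D := d * \prod_(i < m) b i.+1.
have hY x : x < b 0 -> Y x < 2 ^ D /\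
    hamming (Y x) = box_sum m (b \o succn) (fun s => hamming (F (x :: s))).
  by move=> xb; apply: (IH (b \o succn) (fun s => F (x :: s))) => s sb;
     apply: Fd; rewrite /= xb.
rewrite (eq_bigr (fun x : 'I_(b 0) => Y x * (2 ^ D) ^ x)) => [|x _].
  split; last first.
    rewrite hamming_sum => [|x /hY[]//].
    by apply: eq_bigr => x _; have [_ ->] := hY x (ltn_ord x).
  rewrite big_ord_recl mulnCA mulnC expnM /=.
  rewrite (eq_bigr (fun x : 'I_(b 0) =>
    (if x < b 0 then Y x else 0) * (2 ^ D) ^ x)) => [|x _]; last by rewrite ltn_ord.
  apply: (@sum_digits_lt _ _ (fun x => if x < b 0 then Y x else 0)) => x.
  by case: ifP => [/hY[]//|_]; rewrite expn_gt0.
rewrite mulnC -box_sumMl; apply: eq_box_sum => s _.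
rewrite /weight big_ord_recl mulnCA; congr (_ * (_ * _)).
  by rewrite /digit_base big_add1 /= big_mkord.
by apply: eq_bigr => i _; rewrite /digit_base [in LHS]big_add1.
Qed.

(** Coefficient and bases may vary with [n], but the exponents [a i] are fixed, as in
    [definable_powsum]. [expoly_ext] stands in for functional extensionality. *)
Inductive expoly m : (nat -> seq nat -> nat) -> Prop :=
| expoly_monomial c a g : definable c -> (forall i, definable (g i)) ->
    (forall i n, 2 <= n -> 0 < g i n) ->
    expoly m (fun n s => c n * monomial m a (g^~ n) s)
| expolyD F G : expoly m F -> expoly m G -> expoly m (fun n s => F n s + G n s)
| expoly_ext F G : (forall n s, F n s = G n s) -> expoly m F -> expoly m G.

Lemma expoly_cst m c : definable c -> expoly m (fun n _ => c n).
Proof.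
move=> dc; apply: expoly_ext (@expoly_monomial m c (fun=> 0) (fun _ _ => 1) _ _ _) => //.
  by move=> n s; rewrite /monomial big1 ?muln1 // => i _; rewrite exp1n.
by move=> _; apply: definable_cst.
Qed.

Lemma expoly_var m i : i < m -> expoly m (fun _ s => nth 0 s i).
Proof.
move=> im; apply: expoly_ext (@expoly_monomial m (fun=> 1)
  (fun j => (j == i)) (fun _ _ => 1) _ _ _) => //.
- move=> n s; rewrite /monomial (bigD1 (Ordinal im)) //= eqxx exp1n mul1n !muln1.
  by rewrite big1 ?muln1 // => j; rewrite -val_eqE exp1n /= => /negbTE->.
- exact: definable_cst.
- by move=> _; apply: definable_cst.
Qed.

Lemma expoly_exp m i g : i < m -> (forall n, 2 <= n -> 0 < g n) -> definable g ->
  expoly m (fun n s => g n ^ nth 0 s i).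
Proof.
move=> im g0 dg; apply: expoly_ext (@expoly_monomial m (fun=> 1)
  (fun=> 0) (fun j n => if j == i then g n else 1) _ _ _) => //.
- move=> n s; rewrite /monomial (bigD1 (Ordinal im)) //= eqxx !mul1n.
  by rewrite big1 ?muln1 // => j; rewrite -val_eqE /= => /negbTE->; rewrite exp1n.
- exact: definable_cst.
- by move=> j; case: eqP => // _; apply: definable_cst.
- by move=> j n n2; case: eqP => // _; apply: g0.
Qed.

Lemma expolyM m F G : expoly m F -> expoly m G ->
  expoly m (fun n s => F n s * G n s).
Proof.
move=> pF pG; elim: pF => {F} [c a g dc dg g0|F1 F2 _ p1 _ p2|F1 F2 e _ p1].
- elim: pG => {G} [c' a' g' dc' dg' g'0|F1 F2 _ p1 _ p2|F1 F2 e _ p1].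
  + apply: expoly_ext (@expoly_monomial m (fun n => c n * c' n)
      (fun i => a i + a' i) (fun i n => g i n * g' i n) _ _ _).
    * move=> n s; rewrite mulnACA; congr (_ * _); rewrite /monomial -big_split.
      by apply: eq_bigr => i _; rewrite expnD expnMn mulnACA.
    * exact: definableM.
    * by move=> i; apply: definableM.
    * by move=> i n n2; rewrite muln_gt0 g0 ?g'0.
  + by apply: expoly_ext (expolyD p1 p2) => n s; rewrite mulnDr.
  + by apply: expoly_ext p1 => n s; rewrite e.
- by apply: expoly_ext (expolyD p1 p2) => n s; rewrite mulnDl.
- by apply: expoly_ext p1 => n s; rewrite e.
Qed.

(** The weight is absorbed into each monomial by replacing its bases [g i] with [g i * w i]. *)
Lemma definable_box_sum m b w F : expoly m F -> (forall i, definable (b i)) ->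
  (forall i, definable (w i)) -> (forall i n, 2 <= n -> 1 < w i n) ->
  definable (fun n => box_sum m (b^~ n) (fun s => F n s * weight m (w^~ n) s)).
Proof.
move=> pF db dw w1; elim: pF => {F} [c a g dc dg g0|F1 F2 _ p1 _ p2|F1 F2 e _ p1].
- apply: (@definable_ext (fun n => c n *
    \prod_(i < m) \sum_(x < b i n) x ^ a i * (g i n * w i n) ^ x)) => [n _|].
    rewrite -(box_sum_monomial m (b^~ n) a (fun i => g i n * w i n)) -box_sumMl.
    apply: eq_box_sum => s _; rewrite -mulnA -big_split; congr (_ * _).
    by apply: eq_bigr => i _; rewrite expnMn mulnA.
  apply/definableM => //; apply/definable_prod => i; apply/definable_powsum => //.
    by move=> n n2; have := g0 i n n2; have := w1 i n n2; nia.
  exact/definableM.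
- apply: definable_ext (definableD p1 p2) => n _.
  by rewrite -box_sumD; apply: eq_box_sum => s _; rewrite mulnDl.
- by apply: definable_ext p1 => n _; apply: eq_box_sum => s _; rewrite e.
Qed.

(* [L <= R] with equality exactly on [Q]: the zeros of [R - L] are the points
   to be counted. *)
Definition exp_diophantine m (Q : nat -> seq nat -> bool) :=
  exists L R, [/\ expoly m L, expoly m R & forall n s, L n s <= R n s ?= iff Q n s].

(** The square of [F - G] is split into its negative and positive parts, since coefficients are
    natural numbers. *)
Lemma exp_diophantine_eq m F G : expoly m F -> expoly m G ->
  exp_diophantine m (fun n s => F n s == G n s).
Proof.
move=> pF pG; exists (fun n s => 2 * (F n s * G n s)),
  (fun n s => F n s * F n s + G n s * G n s); split.
- by apply: expolyM; [apply/expoly_cst/definable_cst | apply: expolyM].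
- by apply: expolyD; apply: expolyM.
- by move=> n s; rewrite !mulnn; apply: nat_Cauchy.
Qed.

Lemma exp_diophantine_and m Q Q' : exp_diophantine m Q -> exp_diophantine m Q' ->
  exp_diophantine m (fun n s => Q n s && Q' n s).
Proof.
move=> [L [R [pL pR LR]]] [L' [R' [pL' pR' LR']]].
exists (fun n s => L n s + L' n s), (fun n s => R n s + R' n s).
by split=> [||n s]; try exact: expolyD; apply: leqif_add.
Qed.

(* Multiplying a digit by [2 ^ w - 1] gives it Hamming weight [w] unless it
   vanishes, so that the Hamming weight of the sum counts the nonzero digits. *)
Lemma definable_box_count m b Q : exp_diophantine m Q ->
  (forall i, definable (b i)) -> (forall i n, 2 <= n -> 0 < b i n) ->
  definable (fun n => box_sum m (b^~ n) (Q n)).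
Proof.
move=> [L [R [pL pR LR]]] db b0.
(* [w n] exceeds every value of [R n] on the box. The weight with base 2 only enlarges the sum and
   is there because [definable_box_sum] asks for bases greater than 1. *)
pose w n := box_sum m (b^~ n) (fun s => R n s * weight m (fun=> 2) s) + 1.
have dw : definable w.
  apply/definableD/definable_cst/(definable_box_sum (w := fun _ _ => 2)) => //.
  by move=> _; apply: definable_cst.
pose v i n := digit_base m (2 * w n) (b^~ n) i.
have dv i : definable (v i).
  apply/definable_exp2/definableM/definable_prod => //.
  exact/definableM/dw/definable_cst.
have v1 i n : 2 <= n -> 1 < v i n.
  move=> n2; rewrite /v /digit_base -{1}[1]/(2 ^ 0) ltn_exp2l // !muln_gt0 addn_gt0.
  by rewrite orbT prodn_gt0 // => j; apply: b0.
pose S F n := box_sum m (b^~ n) (fun s => F n s * weight m (v^~ n) s).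
apply: (@definable_ext (fun n => \prod_(i < m) b i n
    - hamming ((2 ^ w n - 1) * (S R n - S L n)) %/ w n)); last first.
  apply/definableB; first exact: definable_prod.
  apply/definable_div/dw/definable_hamming/definableM.
    exact/definableB/definable_cst/definable_exp2.
  by apply/definableB; apply: definable_box_sum.
move=> n n2.
have Rw s : in_box m (b^~ n) s -> R n s < w n.
  move=> sb; rewrite /w addn1 ltnS.
  have /= := leq_box_sum (fun s => R n s * weight m (fun=> 2) s) sb.
  by apply: leq_trans; rewrite leq_pmulr // prodn_gt0 // => i; rewrite expn_gt0.
have -> : S R n = S L n + S (fun n s => R n s - L n s) n.
  rewrite -box_sumD; apply: eq_box_sum => s _.
  by rewrite -mulnDl subnKC //; case: (LR n s).
rewrite addKn -box_sumMl.
under [box_sum _ _ _]eq_box_sum => s _ do rewrite mulnA.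
have [|_ ->] := @hamming_box_sum m (2 * w n) (b^~ n)
    (fun s => (2 ^ w n - 1) * (R n s - L n s)).
  move=> s /Rw Rws; have := ltn_expl (w n) (ltnSn 1).
  by rewrite mul2n -addnn expnD; nia.
rewrite (eq_box_sum (G := fun s => w n * ~~ Q n s)) => [|s /Rw Rws /=].
  rewrite box_sumMl mulKn; last by rewrite /w addn1.
  rewrite -[\prod_(i < m) _]mul1n -(box_sum_cst m (b^~ n)).
  rewrite (eq_box_sum (G := fun s => Q n s + ~~ Q n s)) => [|s _].
    by rewrite box_sumD addnK.
  by case: (Q n s).
have [le_LR eq_LR] := LR n s; case: (boolP (Q n s)) => q /=.
  by move: eq_LR; rewrite q => /eqP ->; rewrite subnn muln0 muln0.
rewrite muln1 hamming_mul_pred //.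
have := ltn_expl (w n) (ltnSn 1); move: eq_LR; rewrite (negbTE q); lia.
Qed.

(** * A system counting the [i < n] with [n %| i`! ^ n] *)

Lemma prime_dvd_fact p i : prime p -> (p %| i`!) = (p <= i).
Proof.
move=> pr_p; apply/idP/idP => [|pi]; last by rewrite dvdn_fact // prime_gt0.
elim: i => [|i IH]; first by rewrite dvdn1 => /eqP p1; rewrite p1 in pr_p.
rewrite factS Euclid_dvdM // => /orP[/dvdn_leq->//|/IH]; exact: leqW.
Qed.

(** Both sides say that every prime factor of [n] is at most [i]; the exponent [n] is large enough
    because [logn p n < n]. *)
Lemma dvdn_factX n i : 1 < n -> (n %| i`! ^ n) = (max_pdiv n <= i).
Proof.
move=> n1; apply/idP/idP => [dvd|leP].
  rewrite -prime_dvd_fact ?max_pdiv_prime //.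
  have := dvdn_trans (max_pdiv_dvd n) dvd.
  by rewrite Euclid_dvdX ?max_pdiv_prime // => /andP[].
apply/dvdn_partP => [|p pn]; first exact: ltnW.
have pr_p : prime p by move: pn; rewrite mem_primes => /and3P[].
rewrite p_part; apply: (@dvdn_trans (p ^ n)).
  by rewrite dvdn_exp2l // ltnW // ltn_logl // ltnW.
by rewrite dvdn_exp2r // prime_dvd_fact // (leq_trans (max_pdiv_max pn)).
Qed.

Lemma ffact_leqX r i : r ^_ i <= r ^ i.
Proof. by elim: i => // i IH; rewrite ffactnSr expnSr leq_mul ?leq_subr. Qed.

(* Bernoulli's inequality for [r ^_ i], multiplied by [r] to stay in [nat]. *)
Lemma expn_ffact_bound r i : i <= r -> r * r ^ i <= r * r ^_ i + i ^ 2 * r ^ i.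
Proof.
elim: i => [|i IH] ir; first by rewrite leq_addr.
have := ffact_leqX r i; have {}IH := IH (ltnW ir).
rewrite ffactnSr expnSr; set F := r ^_ i in IH *; set A := r ^ i in IH * => FA.
have -> : r * (F * (r - i)) = r * F * r - r * F * i by rewrite !mulnBr !mulnA.
have : r * F * i <= r * A * i by rewrite !leq_mul.
have : r * A * r <= (r * F + i ^ 2 * A) * r by rewrite leq_mul.
by rewrite -[i.+1]addn1 sqrnD; nia.
Qed.

(** The real quotient is [i! * r ^ i / r ^_ i], at least [i!]; by [expn_ffact_bound] it stays below
    [i! + 1] once [r] is this large. *)
Lemma fact_div_bin r i : i`!.+1 * i ^ 2 < r -> r ^ i %/ 'C(r, i) = i`!.
Proof.
move=> big_r; have ir : i <= r by nia.
have C0 : 0 < 'C(r, i) by rewrite bin_gt0.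
have Af := expn_ffact_bound ir; have FA := ffact_leqX r i.
have A0 : 0 < r ^ i by rewrite expn_gt0; case: i big_r {ir C0 Af FA} => // i; lia.
move: Af FA; rewrite -bin_ffact => Af FA.
have lt : r ^ i < i`!.+1 * 'C(r, i).
  rewrite -(ltn_pmul2l (fact_gt0 i)) -(@ltn_pmul2l r); last by nia.
  nia.
apply/eqP; rewrite eqn_leq leq_divRL // [i`! * _]mulnC FA andbT -ltnS ltn_divLR //.
Qed.

Lemma sum_leq_ord n k : \sum_(i < n) (k <= i) = n - k.
Proof. by elim: n => [|n IH]; rewrite ?big_ord0 // big_ord_recr /= IH; lia. Qed.

Lemma euclid_unique N q d r : N = q * d + r -> r < d -> q = N %/ d /\ r = N %% d.
Proof.
move=> -> rd; have d0 : 0 < d by lia.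
by rewrite divnMDl // divn_small // addn0 modnMDl modn_small.
Qed.

Section System.

Variable n : nat.

(** Large enough for [fact_div_bin] at every [i < n], given [i! <= n ^ n]. *)
Definition bin_arg := (n ^ n + 1) * n ^ 2.
(** Four times [2 ^ bin_arg], so that [x + x' + 1] is a valid digit for all
    [x, x' < 2 ^ bin_arg]. *)
Definition bin_base := 2 ^ (bin_arg + 2).
(** [n ^ n] bits hold [i!] for [i < n], so [n] times as many hold [i! ^ n]. *)
Definition pow_bits := n ^ n * n.
Definition pow_width := pow_bits + n + 1.

Definition bounds := [:: n; bin_base ^ n; bin_base ^ n;
  (1 + bin_base) ^ bin_arg + 1; bin_arg ^ n + 1;
  2 ^ bin_arg; 2 ^ bin_arg; 2 ^ (pow_width * n) + 1; 2 ^ pow_bits].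

(* The first two equations say that [x + x' + 1] is the digit ['C(bin_arg, i)] of
   [(1 + bin_base) ^ bin_arg], the third that [q] is the quotient of
   [bin_arg ^ i] by it, which is [i`!]. The last one divides
   [2 ^ (pow_width * n)] by [2 ^ pow_width - q]: the remainder [q ^ n] must be
   the multiple [n * w] of [n]. The bounds replace the missing inequalities
   [x + x' + 1 < bin_base] and [n * w < 2 ^ pow_width - q]. *)
Definition system (s : seq nat) :=
  let i := nth 0 s 0 in let u := nth 0 s 1 in let u' := nth 0 s 2 in
  let v := nth 0 s 3 in let q := nth 0 s 4 in let x := nth 0 s 5 in
  let x' := nth 0 s 6 in let t := nth 0 s 7 in let w := nth 0 s 8 in
  [&& (1 + bin_base) ^ bin_arg
        == u + (x + x' + 1) * bin_base ^ i + v * (bin_base * bin_base ^ i),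
      u + u' + 1 == bin_base ^ i,
      bin_arg ^ i == q * (x + x' + 1) + x
    & 2 ^ (pow_width * n) + t * q == t * 2 ^ pow_width + n * w].

(** In the order [u, u', v, q, x, x', t, w]; [u'] and [x'] are the slacks that express
    [u < bin_base ^ i] and [x < c] by equations. *)
Definition solution i :=
  let N := (1 + bin_base) ^ bin_arg in let c := 'C(bin_arg, i) in
  [:: N %% bin_base ^ i; bin_base ^ i - 1 - N %% bin_base ^ i; N %/ bin_base ^ i.+1;
      i`!; bin_arg ^ i %% c; c - 1 - bin_arg ^ i %% c;
      2 ^ (pow_width * n) %/ (2 ^ pow_width - i`!); i`! ^ n %/ n].

Hypothesis n2 : 1 < n.

Lemma fact_leq_expnn i : i < n -> i`! <= n ^ n.
Proof.
move=> ltin; rewrite -ffactnn; apply: leq_trans (ffact_leqX i i) _.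
apply: (@leq_trans (n ^ i)); last by rewrite leq_exp2l // ltnW.
by case: i ltin => // i ltin; rewrite leq_exp2r // ltnW.
Qed.

Lemma bin_arg_big i : i < n -> i`!.+1 * i ^ 2 < bin_arg.
Proof.
move=> ltin; have fn := fact_leq_expnn ltin.
apply: (@leq_ltn_trans ((n ^ n + 1) * i ^ 2)).
  by rewrite leq_mul2r addn1 ltnS fn orbT.
by rewrite /bin_arg addn1 ltn_pmul2l // ltn_exp2r.
Qed.

Lemma bin_bin_arg_bounds i : i < n -> 0 < 'C(bin_arg, i) <= 2 ^ bin_arg.
Proof.
move=> ltin; rewrite bin_le_exp2 bin_gt0 andbT.
by have := bin_arg_big ltin; nia.
Qed.

(** The second bound gives [n * w < 2 ^ pow_width - i!] for every [w < 2 ^ pow_bits], so that the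
    last equation of the system is a Euclidean division. *)
Lemma factX_pow_width i : i < n ->
  i`! ^ n < 2 ^ pow_bits /\ n * 2 ^ pow_bits + i`! <= 2 ^ pow_width.
Proof.
move=> ltin; have fn := fact_leq_expnn ltin.
have VV1 : n ^ n <= pow_bits by rewrite /pow_bits leq_pmulr // ltnW.
have fV : i`! < 2 ^ pow_bits.
  apply: leq_ltn_trans fn _; apply: leq_ltn_trans VV1 _; exact: ltn_expl.
split.
  rewrite /pow_bits expnM ltn_exp2r ?(ltnW n2) //.
  by apply: leq_ltn_trans fn _; apply: ltn_expl.
have := ltn_expl n (ltnSn 1); rewrite /pow_width !expnD; nia.
Qed.

Lemma factX_formula i : i < n -> 2 ^ (pow_width * n) %% (2 ^ pow_width - i`!) = i`! ^ n.
Proof. by move=> /factX_pow_width[h1 h2]; rewrite exp2_mod_expn //; nia. Qed.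

Lemma solution_in_box i : i < n ->
  in_box 8 ((nth 1 bounds) \o succn) (solution i).
Proof.
move=> ltin; rewrite /solution /=.
have /andP[c0 c2] := bin_bin_arg_bounds ltin.
have R0 : 0 < bin_base ^ i by rewrite !expn_gt0.
have Rin : bin_base ^ i <= bin_base ^ n.
  rewrite leq_exp2l ?(ltnW ltin) // /bin_base.
  by rewrite -{1}[1]/(2 ^ 0) ltn_exp2l // addn2.
have [fV _] := factX_pow_width ltin.
have fle : i`! <= bin_arg ^ n.
  rewrite -(fact_div_bin (bin_arg_big ltin)); apply: leq_trans (leq_div _ _) _.
  by rewrite leq_exp2l ?(ltnW ltin) //; have := bin_arg_big ltin; rewrite /bin_arg; nia.
have sub1 a d : 0 < a -> a - 1 - d < a by lia.
rewrite (leq_trans (ltn_pmod _ R0) Rin) (leq_trans (sub1 _ _ R0) Rin) !addn1 !ltnS.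
rewrite !leq_div fle (leq_trans (ltn_pmod _ c0) c2) (leq_trans (sub1 _ _ c0) c2).
by rewrite (leq_ltn_trans (leq_div _ _) fV).
Qed.

(** Each equation is a digit extraction or a Euclidean division, so the unknowns are determined in
    turn: the binomial coefficient, [u] and [v], then [q = i!] and [x], then [t] and
    [n * w = i! ^ n]. Only the existence of [w] imposes a condition on [i]. *)
Lemma system_unique i s : i < n -> in_box 8 ((nth 1 bounds) \o succn) s ->
  system (i :: s) = (s == solution i) && (n %| i`! ^ n).
Proof.
move=> ltin; case: s => [|u [|u' [|v [|q [|x [|x' [|t [|w [|? ?]]]]]]]]] //=;
  rewrite ?andbF //= andbT => /and5P[_ _ _ _ /and4P[xb x'b _ wb]].
rewrite /system /= /solution.
have subK a d : a + d + 1 - 1 - a = d by lia.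
have addK a d : a < d -> a + (d - 1 - a) + 1 = d by lia.
have /andP[c0 c2] := bin_bin_arg_bounds ltin.
have R0 : 0 < bin_base ^ i by rewrite !expn_gt0.
have [fV fW] := factX_pow_width ltin.
have RE : bin_base = 2 ^ bin_arg * 4 by rewrite /bin_base expnD.
have binE : (1 + bin_base) ^ bin_arg %/ bin_base ^ i %% bin_base = 'C(bin_arg, i).
  by rewrite -(@bin_digit bin_base) ?RE //; have := expn_gt0 2 bin_arg; lia.
apply/idP/idP.
  case/and4P => /eqP E1 /eqP E2 /eqP E3 /eqP E4.
  have cR : x + x' + 1 < bin_base by lia.
  have uR : u < bin_base ^ i by lia.
  have cE : x + x' + 1 = 'C(bin_arg, i).
    by rewrite -binE E1 -expnS digitP.
  have [vE uE] : v = (1 + bin_base) ^ bin_arg %/ bin_base ^ i.+1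
      /\ u = (1 + bin_base) ^ bin_arg %% bin_base ^ i.
    split.
      apply: (euclid_unique (r := u + (x + x' + 1) * bin_base ^ i) _ _).1.
        by rewrite E1 -expnS; lia.
      rewrite expnS; apply: (@leq_trans ((x + x' + 1).+1 * bin_base ^ i)).
        by rewrite mulSn ltn_add2r.
      by rewrite leq_mul2r cR orbT.
    (* The two upper parts of the expansion are merged into one quotient by [bin_base ^ i]. *)
    apply: (euclid_unique (q := x + x' + 1 + v * bin_base) _ _).2 => //.
    by rewrite E1; lia.
  rewrite cE in E3; have xc : x < 'C(bin_arg, i) by rewrite -cE addn1 ltnS leq_addr.
  have [qE xE] := euclid_unique E3 xc.
  rewrite (fact_div_bin (bin_arg_big ltin)) in qE.
  rewrite qE in E4.
  have [tE wE] : t = 2 ^ (pow_width * n) %/ (2 ^ pow_width - i`!)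
      /\ n * w = 2 ^ (pow_width * n) %% (2 ^ pow_width - i`!).
    clear binE uE vE qE xE; have fW' : t * i`! <= t * 2 ^ pow_width.
      by rewrite leq_mul2l; apply/orP; right; lia.
    have nw : n * w < n * 2 ^ pow_bits by rewrite ltn_pmul2l // ltnW.
    by apply: euclid_unique; rewrite ?mulnBr; lia.
  rewrite factX_formula // in wE.
  rewrite -wE mulKn ?(ltnW n2) // dvdn_mulr // andbT.
  by rewrite -vE -uE -tE -qE -xE -cE -E2 !subK.
case/andP => /eqP[-> -> -> -> -> -> -> ->] dvd.
rewrite !addK ?ltn_pmod //.
apply/and4P; split; apply/eqP.
- rewrite {1}(divn_eq ((1 + bin_base) ^ bin_arg) (bin_base ^ i)).
  rewrite {1}(divn_eq ((1 + bin_base) ^ bin_arg %/ bin_base ^ i) bin_base) binE.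
  rewrite -divnMA -expnSr expnS.
  by lia.
- by [].
- by rewrite -[in X in _ = X * _ + _](fact_div_bin (bin_arg_big ltin)) -divn_eq.
- rewrite [n * _]mulnC divnK // -factX_formula //.
  rewrite {1}(divn_eq (2 ^ (pow_width * n)) (2 ^ pow_width - i`!)) mulnBr.
  set z := _ %/ _; clear binE.
  have : z * i`! <= z * 2 ^ pow_width by rewrite leq_mul2l; apply/orP; right; lia.
  by lia.
Qed.

(** For fixed [i] only [solution i] can contribute, and it does so exactly when
    [max_pdiv n <= i]. *)
Lemma count_system :
  box_sum 9 (nth 1 bounds) system = n - max_pdiv n.
Proof.
rewrite -sum_leq_ord; apply: eq_bigr => i _.
have sb := solution_in_box (ltn_ord i).
have := @box_sum_single 8 _ (fun s => system (val i :: s)) _ sb.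
rewrite /= => H; rewrite H => [|s sb' /negbTE ne].
  by rewrite (system_unique (ltn_ord i) sb) eqxx dvdn_factX.
by rewrite (system_unique (ltn_ord i) sb') ne.
Qed.

End System.

(** * Definability of the bounds and of the system, and the resulting term *)

Lemma definable_bin_arg : definable bin_arg.
Proof.
have di := definable_id.
apply/definableM; last exact/definableX/definable_cst.
exact/definableD/definable_cst/definableX.
Qed.

Lemma definable_bin_base : definable bin_base.
Proof. exact/definable_exp2/definableD/definable_cst/definable_bin_arg. Qed.

Lemma definable_pow_bits : definable pow_bits.
Proof. exact/definableM/definable_id/definableX/definable_id/definable_id. Qed.

Lemma definable_pow_width : definable pow_width.
Proof.
exact/definableD/definable_cst/definableD/definable_id/definable_pow_bits.
Qed.

Lemma definable_bounds k : definable (fun n => nth 1 (bounds n) k).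
Proof.
have [d1 di] := (definable_cst, definable_id).
have [dr dR] := (definable_bin_arg, definable_bin_base).
have [dV dW] := (definable_pow_bits, definable_pow_width).
case: k => [|[|[|[|[|[|[|[|[|k]]]]]]]]] //=;
  try exact/definableX; try exact/definable_exp2.
- exact/definableD/d1/definableX/dr/definableD/dR/d1.
- exact/definableD/d1/definableX.
- exact/definableD/d1/definable_exp2/definableM.
Qed.

(** Beyond the ninth bound, the default value 1 of [nth] keeps this true for all [k]. *)
Lemma bounds_gt0 k n : 2 <= n -> 0 < nth 1 (bounds n) k.
Proof.
move=> n2; case: k => [|[|[|[|[|[|[|[|[|k]]]]]]]]] /=;
  by rewrite ?nth_nil ?expn_gt0 ?addn1 // ltnW.
Qed.

Lemma exp_diophantine_system : exp_diophantine 9 system.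
Proof.
have [[dr dR] dW] := (definable_bin_arg, definable_bin_base, definable_pow_width).
have pv k : k < 9 -> expoly 9 (fun _ s => nth 0 s k) by apply: expoly_var.
have pR : expoly 9 (fun n s => bin_base n ^ nth 0 s 0).
  by apply: expoly_exp => // n _; rewrite expn_gt0.
have pr : expoly 9 (fun n s => bin_arg n ^ nth 0 s 0).
  by apply: expoly_exp => // n n2; rewrite /bin_arg muln_gt0 addn1 expn_gt0 (ltnW n2).
have p1 : expoly 9 (fun=> fun=> 1) by apply/expoly_cst/definable_cst.
have px : expoly 9 (fun _ s => nth 0 s 5 + nth 0 s 6 + 1).
  by apply: expolyD => //; apply: expolyD; apply: pv.
apply: exp_diophantine_and.
  apply: exp_diophantine_eq.
    by apply/expoly_cst/definableX => //; apply/definableD/dR/definable_cst.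
  apply: expolyD; first by apply: expolyD; [apply: pv | apply: expolyM].
  by apply: expolyM; [apply: pv | apply: expolyM => //; apply: expoly_cst].
apply: exp_diophantine_and.
  by apply: exp_diophantine_eq => //; do 2![apply: expolyD => //]; apply: pv.
apply: exp_diophantine_and; apply: exp_diophantine_eq => //.
- by apply: expolyD; [apply: expolyM => //|]; apply: pv.
- apply: expolyD; last by apply: expolyM; apply: pv.
  exact/expoly_cst/definable_exp2/definableM/definable_id/dW.
- apply: expolyD; apply: expolyM; try exact: pv.
    exact/expoly_cst/definable_exp2.
  exact/expoly_cst/definable_id.
Qed.

Theorem theorem3p2 :
  exists T3 : aterm 1,
    forall n : nat, 2 <= n -> aeval (fun _ : 'I_1 => n) T3 = max_pdiv n.
Proof.
apply: (@definable_ext (fun n => n - box_sum 9 (nth 1 (bounds n)) (system n))).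
  by move=> n n2; rewrite count_system // subKn // max_pdiv_leq // ltnW.
apply/definableB/(@definable_box_count 9 (fun k n => nth 1 (bounds n) k)).
- exact: definable_id.
- exact: exp_diophantine_system.
- exact: definable_bounds.
- by move=> k n; apply: bounds_gt0.
Qed.
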